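(* Let $b\geq 2$ be an integer. For Lebesgue almost every angle $\alpha\in\mathbb{T}$ the following two properties hold simultaneously: (1) for every point $\xi\in\alpha+K$, one has $0\leq v_b(\xi)\leq\frac{\kappa}{1-\kappa}$; (2) for every real number $v\in[0,\kappa/(1-\kappa)]$, one has $\dim_H(\mathcal{V}_b(v)\cap(\alpha+K))\leq\frac{1}{v+1}+\kappa-1$.
   Context: $\mathbb{T}=\mathbb{R}/\mathbb{Z}$ is the circle, identified with $[0,1)$. $K$ denotes the image in $\mathbb{T}$ of the middle-third Cantor set $\{\sum_{i\ge1}a_i3^{-i}: a_i\in\{0,2\}\}$, and $\kappa=\log 2/\log 3$; $\alpha+K$ is the rotation of $K$ by $\alpha$. For an irrational real $\xi$, $v_b(\xi)=\sup\{v\in\mathbb{R}: \|b^j\xi\|<b^{-vj}\text{ for infinitely many }j\in\mathbb{N}\}$, where $\|\cdot\|$ is the distance to the nearest integer; for rational $\xi$, $v_b(\xi)=0$ (this is 1-periodic, hence defined on $\mathbb{T}$). For $v\ge0$, $\mathcal{V}_b(v)=\{\xi\in\mathbb{T}: v_b(\xi)\geq v\}$. $\dim_H$ is Hausdorff dimension, with $\dim_H\emptyset=-\infty$. *)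

(* Defs.v *)
(* R : realType. The circle T = R/Z is identified
   with [0,1) via the fractional part. *)
From HB Require Import structures.
From mathcomp Require Import all_boot all_order all_algebra.
From mathcomp Require Import all_classical all_reals all_analysis.
Set Implicit Arguments.
Unset Strict Implicit.
Unset Printing Implicit Defensive.
Import Order.TTheory GRing.Theory Num.Theory.
Import numFieldNormedType.Exports.
Local Open Scope classical_set_scope.
Local Open Scope ring_scope.

Section Defs.
Variable R : realType.

Definition frac_part (x : R) : R := x - (Num.floor x)%:~R.

Definition torus_pt : set R := [set x | 0 <= x < 1].

Definition dnint (x : R) : R :=
  Num.min (x - (Num.floor x)%:~R) ((Num.floor x)%:~R + 1 - x).

Definition cantor_set : set R :=
  [set x | exists a : nat -> bool,
     series (fun i => (a i)%:R * 2 / 3 ^+ i.+1) @ \oo --> x].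

Definition cantorT : set R := frac_part @` cantor_set.

Definition cantor_rot (alpha : R) : set R := [set frac_part (alpha + k) | k in cantorT].

Definition kappa_cantor : R := ln 2 / ln 3.

Definition is_rational (x : R) : Prop := exists q : rat, x = ratr q.

Definition vb (b : nat) (xi : R) : \bar R :=
  if `[< is_rational xi >] then 0%E
  else ereal_sup [set v%:E | v in
        [set v : R | forall N : nat, exists j : nat, (N <= j)%N /\
             dnint ((b%:R) ^+ j * xi) < (b%:R) `^ (- (v * j%:R))]].

Definition Vb (b : nat) (v : R) : set R := [set xi | torus_pt xi /\ (v%:E <= vb b xi)%E].

Definition set_diam (A : set R) : \bar R :=
  ereal_sup [set `|x - y|%:E | x in A & y in A].

Definition hterm (s : R) (A : set R) : \bar R :=
  if `[< A = set0 >] then 0%E else ((fine (set_diam A)) `^ s)%:E.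

Definition hausdorff_content (s d : R) (E : set R) : \bar R :=
  ereal_inf [set (\sum_(0 <= i <oo) hterm s (U i))%E | U in
     [set U : nat -> set R | E `<=` \bigcup_i U i /\
                              forall i, (set_diam (U i) <= d%:E)%E]].

(* H^s(E) = lim_{delta -> 0+} H^s_delta(E) = sup_{delta > 0} H^s_delta(E) *)
Definition hausdorff_measure (s : R) (E : set R) : \bar R :=
  ereal_sup [set hausdorff_content s d E | d in [set d : R | 0 < d]].

Definition dimH (E : set R) : \bar R :=
  if `[< E = set0 >] then -oo%E
  else ereal_inf [set s%:E | s in [set s : R | 0 <= s /\ hausdorff_measure s E = 0%E]].

End Defs.

(* Main.v *)
(* First-moment argument. If b^j xi is within b^(-v j) of an integer, then xi lies
   in an interval of radius r_j = b^(-(1+v)j) around some p/b^j. The rotation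
   alpha + K meets such an interval only if alpha is within r_j of p/b^j - K
   modulo 1, and K is covered by about r_j^(-kappa) intervals of length r_j, so
   the set of these alpha has measure O(r_j^(1-kappa)). Weighting each interval
   that is met by r_j^s, the expected total weight is
   O(sum_j b^j r_j^(s+1-kappa)), finite once (1+v)(s+1-kappa) > 1. Hence for
   almost every alpha the total weight is finite, and its tails show that the
   points of alpha + K with exponent > v form an H^s-null set. Since only
   countably many rational (v, s) are needed, this gives the dimension bound;
   the bound on v_b is the case s = 0, where H^0 is the counting measure and an
   H^0-null set is empty. *)
Require Import Defs.
From HB Require Import structures.
From mathcomp Require Import all_boot all_order all_algebra.
From mathcomp Require Import all_classical all_reals all_analysis.
From mathcomp Require Import measurable_realfun ring lra.
Import Order.TTheory GRing.Theory Num.Theory.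
Import numFieldNormedType.Exports.
Local Open Scope classical_set_scope.
Local Open Scope ring_scope.

(** * Diameters, Hausdorff contents and Hausdorff-null sets *)

Lemma set_diam0 (R : realType) : set_diam (set0 : set R) = -oo%E.
Proof.
rewrite /set_diam (_ : [set _ | _ in _ & _ in _] = set0) ?ereal_sup0//.
by apply/seteqP; split=> // x [].
Qed.

Lemma set_diam_ball (R : realType) (y r : R) :
  (set_diam (ball y r) <= (2 * r)%:E)%E.
Proof.
apply: ge_ereal_sup => _ [u yu [v yv <-]]; rewrite lee_fin.
move: yu yv; rewrite /ball/= !ltr_norml => /andP[? ?] /andP[? ?].
by rewrite ler_norml; lra.
Qed.

Lemma hterm_ge0 (R : realType) (s : R) (A : set R) : (0 <= hterm s A)%E.
Proof. by rewrite /hterm; case: ifP => // _; rewrite lee_fin powR_ge0. Qed.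

Lemma hterm_set0 (R : realType) (s : R) : hterm s set0 = 0%E.
Proof. by rewrite /hterm asboolT. Qed.

Lemma hterm_le (R : realType) (s d : R) (A : set R) : 0 <= s -> 0 <= d ->
  (set_diam A <= d%:E)%E -> (hterm s A <= (d `^ s)%:E)%E.
Proof.
move=> s0 d0 Ad; rewrite /hterm; case: ifPn => [_|/asboolPn/eqP/set0P[x Ax]].
  by rewrite lee_fin powR_ge0.
have A0 : (0 <= set_diam A)%E.
  by apply: ereal_sup_ubound; exists x => //; exists x => //; rewrite subrr normr0.
rewrite lee_fin ge0_ler_powR// ?nnegrE ?fine_ge0//.
by rewrite -lee_fin fineK// ge0_fin_numE// (le_lt_trans Ad)// ltry.
Qed.

(** Covers below come indexed by stage and by position within the stage. A bijection of [nat] with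
    [nat * nat] flattens them into one sequence; the terms being nonnegative, the order of summation
    is irrelevant. *)
Lemma hausdorff_content_le2 (R : realType) (s d : R) (E : set R)
    (U : nat -> nat -> set R) :
  E `<=` \bigcup_i \bigcup_j U i j ->
  (forall i j, (set_diam (U i j) <= d%:E)%E) ->
  (hausdorff_content s d E <= \sum_(i <oo) \sum_(j <oo) hterm s (U i j))%E.
Proof.
move=> EU Ud.
have /card_esym/ppcard_eqP[f] := card_nat2.
apply: (@le_trans _ _ (\sum_(i <oo) hterm s (uncurry U (f i)))%E).
  apply: ereal_inf_lbound; exists (uncurry U \o f) => //; split=> [x /EU|i].
    by move=> [i _ [j _ Ux]]; exists (f^-1%FUN (i, j)) => //=; rewrite invK ?inE.
  by rewrite /=; case: (f i) => m n; exact: Ud.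
rewrite nneseries_esum; last by move=> *; exact: hterm_ge0.
rewrite [leRHS]nneseries_esum; last first.
  by move=> *; apply: nneseries_ge0 => *; exact: hterm_ge0.
under [leRHS]eq_esum => i _.
  rewrite nneseries_esum; last by move=> *; exact: hterm_ge0.
  over.
rewrite esum_esum; last by move=> *; exact: hterm_ge0.
have -> : [set x : nat | true] = setT by apply/seteqP.
have -> : setT `*`` (fun _ : nat => setT) = [set: nat * nat].
  by apply/seteqP; split=> // -[].
rewrite (@reindex_esum _ _ _ setT setT f)//.
by rewrite le_eqVlt; apply/orP; left; apply/eqP/eq_esum => i _; case: (f i).
Qed.

Lemma hausdorff_measure_ge0 (R : realType) (s : R) (E : set R) :
  (0 <= hausdorff_measure s E)%E.
Proof.
apply: (@le_trans _ _ (hausdorff_content s 1 E)).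
  apply: le_ereal_inf_tmp => _ [U _ <-].
  by apply: nneseries_ge0 => *; exact: hterm_ge0.
by apply: ereal_sup_ubound; exists 1 => /=.
Qed.

Lemma hausdorff_measure0_subset (R : realType) (s : R) (E F : set R) :
  E `<=` F -> hausdorff_measure s F = 0%E -> hausdorff_measure s E = 0%E.
Proof.
move=> EF F0; apply/eqP; rewrite eq_le hausdorff_measure_ge0 andbT -F0.
apply: ge_ereal_sup => _ [d d0 <-].
apply: (@le_trans _ _ (hausdorff_content s d F)).
  apply: le_ereal_inf_tmp => _ [U [FU Ud] <-].
  by apply: ereal_inf_lbound; exists U => //; split=> //; exact: subset_trans FU.
by apply: ereal_sup_ubound; exists d.
Qed.

Lemma hausdorff_measure0_set0 (R : realType) (E : set R) :
  hausdorff_measure 0 E = 0%E -> E = set0.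
Proof.
move=> E0; apply: contrapT => /eqP/set0P[x Ex].
suff : (1 <= hausdorff_measure 0 E)%E by rewrite E0 lee_fin ler10.
apply: (@le_trans _ _ (hausdorff_content 0 1 E)); last first.
  by apply: ereal_sup_ubound; exists 1 => /=.
apply: le_ereal_inf_tmp => _ [U [EU _] <-].
have [i _ Ux] := EU _ Ex.
apply: le_trans (nneseries_lim_ge i.+1 _) => [|*]; last exact: hterm_ge0.
rewrite big_nat_recr//= -[leLHS]add0e leeD//.
  by apply: sume_ge0 => *; exact: hterm_ge0.
rewrite /hterm asboolF; first by rewrite powRr0.
by move=> U0; rewrite U0 in Ux.
Qed.

(** * First moment bound and limsup covers *)

Lemma ae_weighted_hits_lty (R : realType) (d : measure_display)
    (T : measurableType d) (mu : {measure set T -> \bar R}) (J : Type)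
    (c : nat -> seq J) (A : nat -> J -> set T) (w m : nat -> R) :
  (forall j p, measurable (A j p)) -> (forall j p, (mu (A j p) <= (m j)%:E)%E) ->
  (forall j, 0 <= w j) ->
  (\sum_(j <oo) ((size (c j))%:R * (w j * m j))%:E < +oo)%E ->
  {ae mu, forall x : T,
    (\sum_(j <oo) \sum_(p <- c j) (w j * \1_(A j p) x)%:E < +oo)%E}.
Proof.
move=> mA Am w0 sumlty.
pose h j p x : \bar R := (w j * \1_(A j p) x)%:E.
have h0 j p x : (0 <= h j p x)%E by rewrite lee_fin mulr_ge0.
have mh j p : measurable_fun setT (h j p).
  by apply/measurable_EFinP; apply: measurable_funM => //; exact/measurable_indic.
pose f j x := (\sum_(p <- c j) h j p x)%E.
have f0 j x : (0 <= f j x)%E by apply: sume_ge0.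
have mf j : measurable_fun setT (f j) by apply: emeasurable_sum.
have F0 x : (0 <= \sum_(j <oo) f j x)%E by apply: nneseries_ge0.
(* Sum and integral are exchanged (all terms are nonnegative): stage [j] contributes at most
   [size (c j) * w j * m j]. A function with finite integral is finite almost everywhere. *)
have intf : mu.-integrable setT (fun x => \sum_(j <oo) f j x)%E.
  apply/integrableP; split; first exact: ge0_emeasurable_sum.
  under eq_integral do rewrite gee0_abs//.
  rewrite integral_nneseries//; apply: le_lt_trans sumlty.
  apply: lee_nneseries => [*|j _]; first exact: integral_ge0.
  rewrite ge0_integral_sum// -sum1_size natr_sum mulr_suml -sumEFin lee_sum// => p _.
  rewrite /h; under eq_integral do rewrite EFinM.
  have m1 : measurable_fun setT (fun x => (\1_(A j p) x)%:E : \bar R).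
    exact/measurable_EFinP/measurable_indic.
  rewrite ge0_integralZl_EFin//.
  by rewrite integral_indic// setIT mul1r EFinM lee_wpmul2l// lee_fin.
have := integrable_ae measurableT intf.
by apply: filterS => x /(_ I); rewrite ge0_fin_numE.
Qed.

(** A pair [p] holds a centre [p.1] tested against the angle and a centre [p.2] of a covering ball.
    The balls selected from stage [N] on cover [E], their weight is the tail of a convergent series,
    and [r] tending to 0 meets any bound on the diameters. *)
Lemma hausdorff_measure0_limsup (R : realType) (s alpha : R)
    (c : nat -> seq (R * R)) (r rho : nat -> R) (E : set R) :
  0 <= s -> (forall j, 0 <= r j) -> r @ \oo --> (0 : R) ->
  (\sum_(j <oo) \sum_(p <- c j)
     ((2 * r j) `^ s * \1_(ball p.1 (rho j)) alpha)%:E < +oo)%E ->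
  (forall xi, E xi -> forall N, exists j, (N <= j)%N /\
     exists2 p, p \in c j & ball p.1 (rho j) alpha /\ ball p.2 (r j) xi) ->
  hausdorff_measure s E = 0%E.
Proof.
move=> s0 r0 rcvg sumlty limE.
pose g j := (\sum_(p <- c j) ((2 * r j) `^ s * \1_(ball p.1 (rho j)) alpha)%:E)%E.
have {}sumlty : (\sum_(j <oo) g j < +oo)%E by [].
have g0 j : (0 <= g j)%E.
  by apply: sume_ge0 => p _; rewrite lee_fin mulr_ge0// powR_ge0.
apply/eqP; rewrite eq_le hausdorff_measure_ge0 andbT.
apply: ge_ereal_sup => _ [d /= d0 <-].
apply/lee_addgt0Pr => e e0; rewrite add0e.
have tail := nneseries_tail_cvg sumlty (fun k _ => g0 k).
have [N _ NP] : \forall N \near \oo,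
    (\sum_(N <= k <oo) g k <= e%:E)%E /\ forall j, (N <= j)%N -> 2 * r j <= d.
  near=> N; split.
    near: N; have : \forall N \near \oo, (\sum_(N <= k <oo) g k < e%:E)%E.
      move: tail => /(_ [set x | (x < e%:E)%E]); apply.
      by apply: open_nbhs_nbhs; split; [exact: open_ereal_lt_ereal|rewrite /= lte_fin].
    by apply: filterS => n /ltW.
  near: N; have /cvgrPdist_le/(_ (d / 2)) := rcvg.
  rewrite divr_gt0// => /(_ isT)[M _ MP]; exists M => // n /= Mn j nj.
  have := MP j (leq_trans Mn nj); rewrite sub0r normrN ger0_norm// => ?.
  by rewrite mulrC -ler_pdivlMr.
have {NP} [Ne Nd] := NP N (leqnn N).
(* Stages are shifted by [N]. Positions past the end of the list, or whose angle test fails, get the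
   empty set, which has weight 0. *)
pose U i k := let p := nth (0, 0) (c (i + N)%N) k in
  if (k < size (c (i + N)%N))%N && `[< ball p.1 (rho (i + N)%N) alpha >]
  then ball p.2 (r (i + N)%N) else set0.
apply: le_trans Ne; rewrite -nneseries_addn//.
apply: (le_trans (@hausdorff_content_le2 _ s d E U _ _)).
- move=> xi /limE/(_ N)[j [Nj [p pc [pa px]]]].
  exists (j - N)%N => //; exists (index p (c j)) => //.
  by rewrite /U subnK// nth_index// index_mem pc/= asboolT.
- move=> i k; rewrite /U; case: ifP => _; last by rewrite set_diam0 leNye.
  by apply: (le_trans (@set_diam_ball _ _ _)); rewrite lee_fin Nd// leq_addl.
apply: lee_nneseries => [*|i _].
  by apply: nneseries_ge0 => *; exact: hterm_ge0.
set m := size (c (i + N)%N).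
rewrite (nneseries_split 0 m) ?add0n; last by move=> *; exact: hterm_ge0.
rewrite [X in (_ + X)%E]eseries0 => [|k mk _]; last first.
  by rewrite /U ltnNge mk/= hterm_set0.
rewrite adde0 /g (big_nth (0, 0)) !big_nat; apply: lee_sum => k /andP[_ km].
rewrite /U km/= indicE; case: asboolP => pa.
  rewrite mem_set// mulr1; apply: hterm_le => //; last exact: set_diam_ball.
  by rewrite mulr_ge0.
by rewrite memNset// hterm_set0 mulr0.
Unshelve. all: by end_near. Qed.

(** * Triadic covers of the Cantor set *)

Definition cantor_level (R : realType) (n : nat) : seq R :=
  [seq \sum_(i < n) (t i)%:R * 2 / 3 ^+ i.+1 | t : {ffun 'I_n -> bool}].

Lemma size_cantor_level (R : realType) (n : nat) :
  size (cantor_level R n) = (2 ^ n)%N.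
Proof. by rewrite size_map -cardE card_ffun card_bool card_ord. Qed.

(** [q] truncates the expansion of [x] to [n] digits: it is the left endpoint of the level-[n]
    Cantor interval containing [x]. *)
Lemma cantor_level_approx (R : realType) (n : nat) (x : R) : cantor_set x ->
  exists2 q, q \in cantor_level R n & q <= x <= q + (3 ^+ n)^-1.
Proof.
move=> [a ax]; set u := (fun i => _) in ax.
have uE i : u i = (a i)%:R * 2 / 3 ^+ i.+1 by [].
exists (series u n).
  apply/mapP; exists [ffun i : 'I_n => a i]; first by rewrite mem_enum.
  by rewrite seriesEord; apply: eq_bigr => i _; rewrite ffunE.
(* The subtracted term makes the induction close: a further digit adds at most
   [2 / 3 ^+ (k + n).+1], exactly the decrease of [(3 ^+ (k + n))^-1]. *)
have tail k : series u n <= series u (k + n)%N <=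
    series u n + (3 ^+ n)^-1 - (3 ^+ (k + n))^-1.
  elim: k => [|k IH]; first by rewrite add0n addrK !lexx.
  rewrite addSn seriesSr uE exprS invfM.
  have : 0 < (3 ^+ (k + n) : R)^-1 by rewrite invr_gt0 exprn_gt0.
  move: IH; set w := (3 ^+ (k + n))^-1; set S := series u (k + n)%N.
  by case: (a _) => /= /andP[? ?] ?; apply/andP; split; lra.
have near_tail (P : set R) : (forall k, P (series u (k + n)%N)) ->
    \forall m \near \oo, P (series u m).
  by move=> H; exists n => // m /= nm; rewrite -(subnK nm).
apply/andP; split.
  apply: (cvgr_to_ge ax).
  by apply: (near_tail [set y | series u n <= y]) => k; case/andP: (tail k).
apply: (cvgr_to_le ax).
apply: (near_tail [set y | y <= series u n + (3 ^+ n)^-1]) => k /=.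
case/andP: (tail k) => _ /le_trans; apply.
by rewrite lerBlDr lerDl invr_ge0 exprn_ge0.
Qed.

Lemma cantor_set01 (R : realType) (x : R) : cantor_set x -> 0 <= x <= 1.
Proof.
move=> /(cantor_level_approx _ 0)[q /mapP[t _ ->]].
by rewrite big_ord0 expr0 invr1 add0r.
Qed.

(** * From good approximations to constraints on the angle *)

Lemma dnint_lt1 (R : realType) (y : R) : dnint y < 1.
Proof.
have := floor_itv y; rewrite /dnint intrD => /andP[? ?].
by rewrite gt_min; apply/orP; left; lra.
Qed.

Lemma lt_vb_io (R : realType) (b : nat) (v xi : R) : (1 <= b)%N ->
  (v%:E < vb b xi)%E -> forall N, exists j, (N <= j)%N /\
    dnint (b%:R ^+ j * xi) < b%:R `^ (- (v * j%:R)).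
Proof.
move=> b1; rewrite /vb; case: ifPn => _.
  (* For rational [xi] the exponent is 0 by convention, so [v < 0] and the threshold is at least
     1. *)
  rewrite lte_fin => v0 N; exists N; split=> //.
  apply: (lt_le_trans (dnint_lt1 _ _)).
  rewrite -[leLHS](powRr0 (b%:R : R)) ler_powR ?ler1n// oppr_ge0.
  by apply: mulr_le0_ge0; [exact: ltW|exact: ler0n].
move=> /ereal_sup_gt[_ [v' v'P <-]]; rewrite lte_fin => vv' N.
have [j [Nj jP]] := v'P N; exists j; split=> //.
apply: lt_le_trans jP _; rewrite ler_powR ?ler1n// lerN2.
by rewrite ler_wpM2r// ltW.
Qed.

(** The value [p = B] occurs when [y] lies just below [B]; hence the [B + 1] numerators counted
    later. *)
Lemma dnint_nat (R : realType) (B : nat) (y d : R) :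
  0 <= y < B%:R -> dnint y < d -> exists2 p, (p <= B)%N & `|y - p%:R| < d.
Proof.
move=> /andP[y0 yB]; have /andP[fy yf] := floor_itv y.
have f0 : 0 <= Num.floor y by rewrite floor_ge0.
rewrite /dnint; move: fy yf; case: (Num.floor y) f0 => // k _.
rewrite -[(k%:Z + 1)]/((k + 1)%N%:Z) -!pmulrn natrD => ky yk.
have kB : (k < B)%N by rewrite -(ltr_nat R); lra.
rewrite gt_min => /orP[?|?].
  by exists k; [exact: ltnW|rewrite ger0_norm; lra].
by exists k.+1 => //; rewrite -natr1 ler0_norm; lra.
Qed.

Lemma cantor_rot_hit (R : realType) (B n : nat) (d alpha xi : R) :
  (0 < B)%N -> torus_pt alpha -> cantor_rot alpha xi -> dnint (B%:R * xi) < d ->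
  exists p m q, [/\ (p <= B)%N, (m < 2)%N & q \in cantor_level R n] /\
    `|p%:R / B%:R + m%:R - q - alpha| < d / B%:R + (3 ^+ n)^-1 /\
    `|p%:R / B%:R - xi| < d / B%:R.
Proof.
move=> B0 /andP[a0 a1] [_ [x Kx <-] <-].
have /andP[x0 x1] := cantor_set01 _ _ Kx.
have [q qn /andP[qx xq]] := cantor_level_approx _ n _ Kx.
rewrite {1 2}/frac_part.
set M := Num.floor (alpha + frac_part x).
have := floor_itv (alpha + frac_part x); rewrite -/M intrD => /andP[M1 M2].
have := floor_itv x; rewrite intrD.
rewrite /frac_part in M1 M2 *; set L := Num.floor x in M1 M2 * => /andP[L1 L2].
set y := (alpha + _ - _).
have BR : 0 < B%:R :> R by rewrite ltr0n.
have y0 : 0 <= y by rewrite /y; lra.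
have y1 : y < 1 by rewrite /y; lra.
(* The two fractional parts remove [L] and [M]. As [alpha + x] lies in [[0, 2)] and [y] in [[0, 1)],
   their sum [M + L] is 0 or 1. *)
have [m m2 mE] : exists2 m : nat, (m < 2)%N & alpha + x = y + m%:R.
  have e : alpha + x = y + (M + L)%:~R by rewrite intrD /y; lra.
  have h1 : (-1)%:~R < (M + L)%:~R :> R by rewrite mulrNz; lra.
  have h2 : (M + L)%:~R < 2%:~R :> R by rewrite -pmulrn; lra.
  move: h1 h2 e; rewrite !ltr_int; case: (M + L) => // k _ k2 ->.
  by exists k.
move=> /(dnint_nat _ B)[|p pB].
  by rewrite mulr_ge0 ?ler0n//= gtr_pMr.
move=> pd; exists p, m, q; split=> //.
have pB' : `|p%:R / B%:R - y| < d / B%:R.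
  rewrite ltr_pdivlMr// -[X in _ * X](gtr0_norm BR) -normrM mulrBl divfK ?gt_eqF//.
  by rewrite distrC mulrC.
split=> //; move: pB'; rewrite !ltr_norml => /andP[? ?].
by apply/andP; split; lra.
Qed.

(** * The exponent [kappa] and convergence of the expected weight *)

Lemma kappa_cantor_gt0_lt1 (R : realType) : 0 < kappa_cantor R < 1.
Proof.
have l2 : 0 < ln (2 : R) by rewrite ln_gt0// ltr1n.
have l23 : ln (2 : R) < ln 3 by rewrite ltr_ln ?posrE// ltr_nat.
have l3 := lt_trans l2 l23.
by rewrite /kappa_cantor divr_gt0//= ltr_pdivrMr// mul1r.
Qed.

(** Turns the number of level-[n] Cantor pieces into a power of their scale. *)
Lemma powR_pow3_kappa (R : realType) (n : nat) :
  (3 ^+ n : R) `^ kappa_cantor R = 2 ^+ n.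
Proof.
have l3 : 0 < ln (3 : R) by rewrite ln_gt0// ltr1n.
rewrite -!powR_mulrn// -powRrM mulrC powRrM; congr (_ `^ _).
by rewrite /powR pnatr_eq0/= /kappa_cantor divfK ?gt_eqF// lnK ?posrE.
Qed.

Lemma powR_lt1 (R : realType) (x e : R) : 1 < x -> 0 < e -> x `^ (- e) < 1.
Proof.
move=> x1 e0; rewrite /powR gt_eqF ?(lt_trans ltr01)// expR_lt1 mulNr.
by rewrite oppr_lt0 mulr_gt0// ln_gt0.
Qed.

Lemma powRN_natM (R : realType) (x e : R) (j : nat) :
  x `^ (- (e * j%:R)) = (x `^ (- e)) ^+ j.
Proof. by rewrite -mulNr powRrM powR_mulrn// powR_ge0. Qed.

Lemma exists_pow3_bracket (R : realType) (x : R) : 1 <= x ->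
  exists n : nat, 3 ^+ n <= x < 3 ^+ n.+1.
Proof.
move=> x1; have /andP[x0 xS] := truncn_itv (le_trans ler01 x1).
have t0 : (0 < Num.truncn x)%N by rewrite truncn_gt0.
have /andP[n1 n2] := trunc_log_bounds (isT : 1 < 3)%N t0.
exists (trunc_log 3 (Num.truncn x)); rewrite -!natrX; apply/andP; split.
  by apply: le_trans x0; rewrite ler_nat.
by apply: lt_le_trans xS _; rewrite ler_nat.
Qed.

(* The three factors of the cardinality are the numerators p <= b ^ j, the
   integer translate 0 or 1, and the Cantor pieces at the scale of the radius. *)
Lemma hits_summable (R : realType) (b : nat) (s u : R) (n : nat -> nat) :
  (2 <= b)%N -> 0 <= s -> 1 < u * (s + 1 - kappa_cantor R) ->
  (forall j, 3 ^+ n j <= (b%:R `^ (- (u * j%:R)))^-1 :> R) ->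
  (\sum_(j <oo) (((b ^ j).+1 * 2 * 2 ^ n j)%:R *
     ((2 * b%:R `^ (- (u * j%:R))) `^ s *
      ((4 * b%:R `^ (- (u * j%:R))) *+ 2)))%:E < +oo)%E.
Proof.
move=> b2 s0 us nP; set k := kappa_cantor R in us.
have /andP[k0 k1] := kappa_cantor_gt0_lt1 R.
have b1 : 1 < b%:R :> R by rewrite ltr1n.
have b0 : 0 < b%:R :> R by rewrite (lt_trans ltr01).
have bz : (b%:R : R) != 0 by rewrite gt_eqF.
(* With [r = b ^ (-(u j))], the product [b ^ j * r ^ (s + 1 - k)] is [z ^ j]. The constant 32
   collects 2 from [b ^ j + 1 <= 2 b ^ j], 2 translates, and 8 from the length [8 r] of a ball of
   radius [4 r]. *)
pose z : R := b%:R `^ (- (u * (s + 1 - k) - 1)).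
pose C : R := 32 * 2 `^ s.
have C0 : 0 <= C by rewrite mulr_ge0// powR_ge0.
have z1 : `|z| < 1 by rewrite ger0_norm ?powR_ge0// powR_lt1// subr_gt0.
have term j : ((b ^ j).+1 * 2 * 2 ^ n j)%:R *
     ((2 * b%:R `^ (- (u * j%:R))) `^ s *
      ((4 * b%:R `^ (- (u * j%:R))) *+ 2)) <= geometric C z j.
  set r := b%:R `^ (- (u * j%:R)).
  have r0 : 0 < r by rewrite powR_gt0.
  have rz : r != 0 by rewrite gt_eqF.
  have card2 : 2 ^+ n j <= r `^ (- k).
    rewrite -powR_pow3_kappa powRN -powR_inv1 ?powR_ge0// powRAC powR_inv1 ?(ltW r0)//.
    by rewrite ge0_ler_powR ?nnegrE ?invr_ge0 ?exprn_ge0 ?(ltW k0) ?(ltW r0)// nP.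
  have zE : z ^+ j = b%:R ^+ j * (r `^ s * r * r `^ (- k)).
    rewrite -powRN_natM -{2}(powRr1 (ltW r0)) -!powRD ?rz ?implybT//.
    rewrite -powR_mulrn ?ltW// -powRrM -powRD ?bz ?implybT//.
    by congr powR; ring.
  rewrite /= zE !natrM natrX powRM ?(ltW r0)// /C.
  have Q1 : (b ^ j).+1%:R <= 2 * b%:R ^+ j :> R.
    rewrite -natrX -natrM ler_nat mul2n -addnn -addn1 leq_add2l expn_gt0.
    by rewrite (leq_trans _ b2).
  apply: (@le_trans _ _ (2 * b%:R ^+ j * 2 * r `^ (- k) *
      (2 `^ s * r `^ s * (4 * r *+ 2)))).
    rewrite ler_wpM2r//; last by rewrite ler_pM// ?mulr_ge0// ler_wpM2r.
    by rewrite !mulr_ge0 ?powR_ge0// mulrn_wge0// mulr_ge0// ltW.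
  by rewrite le_eqVlt; apply/orP; left; apply/eqP; ring.
apply: (@le_lt_trans _ _ (\sum_(j <oo) (geometric C z j)%:E)%E).
  apply: lee_nneseries => [j _ _|j _]; last by rewrite lee_fin.
  by rewrite lee_fin !mulr_ge0// ?powR_ge0// mulrn_wge0// mulr_ge0// powR_ge0.
under eq_fun do rewrite sumEFin.
rewrite EFin_lim ?ltry//; exact: is_cvg_geometric_series.
Qed.

(** * Null sets for almost every angle, and the theorem *)

Lemma ae_lebesgueS (R : realType) (P Q : R -> Prop) : (forall x, P x -> Q x) ->
  {ae (@lebesgue_measure R), forall x : R, P x} ->
  {ae (@lebesgue_measure R), forall x : R, Q x}.
Proof.
have F := ae_filter_ringOfSetsType (@lebesgue_measure R).
exact: (@filterS _ _ F P Q).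
Qed.

Lemma ae_cantor_rot_hausdorff0 (R : realType) (b : nat) (v s : R) :
  (2 <= b)%N -> 0 <= s -> 1 < (v + 1) * (s + 1 - kappa_cantor R) ->
  {ae (@lebesgue_measure R), forall alpha : R, torus_pt alpha ->
     hausdorff_measure s
       [set xi | cantor_rot alpha xi /\ (v%:E < vb b xi)%E] = 0%E}.
Proof.
move=> b2 s0 vs.
have /andP[k0 k1] := kappa_cantor_gt0_lt1 R.
have b1 : 1 < b%:R :> R by rewrite ltr1n.
have b0 : 0 < b%:R :> R by rewrite (lt_trans ltr01).
(* [v] itself may be negative; positivity of [v + 1] comes from [vs]. *)
have u0 : 0 < v + 1.
  have sk : 0 < s + 1 - kappa_cantor R by lra.
  by rewrite -(pmulr_lgt0 _ sk) (lt_trans ltr01).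
pose r j : R := b%:R `^ (- ((v + 1) * j%:R)).
have r0 j : 0 < r j by rewrite powR_gt0.
have rexp j : r j = (b%:R `^ (- (v + 1))) ^+ j by rewrite /r powRN_natM.
have z1 : b%:R `^ (- (v + 1)) < 1 :> R by rewrite powR_lt1.
have r1 j : 1 <= (r j)^-1.
  by rewrite invf_ge1// rexp exprn_ile1// ?powR_ge0// ltW.
(* The Cantor level is matched to the radius: the lower bound limits the number of pieces, the upper
   one gives [3 ^ (- n j) < 3 r j]. *)
have /choice[n nP] : forall j, exists n : nat, 3 ^+ n <= (r j)^-1 < 3 ^+ n.+1.
  by move=> j; exact: exists_pow3_bracket.
pose c j : seq (R * R) :=
  [seq (pm.1%:R / b%:R ^+ j + pm.2%:R - q, pm.1%:R / b%:R ^+ j) |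
    pm <- [seq (p, m) | p <- iota 0 (b ^ j).+1, m <- iota 0 2],
    q <- cantor_level R (n j)].
have sc j : size (c j) = ((b ^ j).+1 * 2 * 2 ^ n j)%N.
  by rewrite !size_allpairs !size_iota size_cantor_level.
have sumlty : (\sum_(j <oo) ((size (c j))%:R *
    ((2 * r j) `^ s * ((4 * r j) *+ 2)))%:E < +oo)%E.
  under eq_eseriesr => j _ do rewrite sc.
  by apply: hits_summable => // j; case/andP: (nP j).
have rcvg : r @ \oo --> (0 : R).
  rewrite (_ : r = fun j => (b%:R `^ (- (v + 1))) ^+ j); last exact/funext.
  by apply: cvg_expr; rewrite ger0_norm ?powR_ge0.
(* The angle radius [4 * r j] is [r j] from the approximation plus [3 * r j] from the Cantor
   piece. *)
have := ae_weighted_hits_lty _ _ _ (@lebesgue_measure R) _ c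
  (fun j p => ball p.1 (4 * r j)) (fun j => (2 * r j) `^ s)
  (fun j => (4 * r j) *+ 2).
move=> /(_ (fun j p => measurable_ball _ _)) /(_ _ _ sumlty) H.
have {H} : {ae (@lebesgue_measure R), forall alpha : R,
    (\sum_(j <oo) \sum_(p <- c j)
      ((2 * r j) `^ s * \1_(ball p.1 (4 * r j)) alpha)%:E < +oo)%E}.
  apply: H => j; last exact: powR_ge0.
  by move=> p; rewrite /= lebesgue_measure_ball// mulr_ge0// ltW.
apply: ae_lebesgueS => alpha alphalty ta.
apply: hausdorff_measure0_limsup alphalty _ => // [j|xi [Kxi vxi] N].
  exact: ltW.
have [j [Nj dj]] := lt_vb_io _ _ _ _ (ltnW b2) vxi N.
exists j; split=> //.
have bj : (0 < b ^ j)%N by rewrite expn_gt0 (ltnW b2).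
rewrite -natrX in dj.
have [p [m [q [[pb m2 qn] []]]]] := cantor_rot_hit _ _ (n j) _ _ _ bj ta Kxi dj.
have -> : b%:R `^ (- (v * j%:R)) / (b ^ j)%:R = r j.
  rewrite natrX -powR_mulrn ?(ltW b0)// -powRB ?(gt_eqF b0) ?implybT//.
  by congr powR; ring.
have n3 : (3 ^+ n j)^-1 < 3 * r j.
  case/andP: (nP j) => _; rewrite exprS => rn.
  rewrite -ltf_pV2 ?posrE ?invr_gt0 ?mulr_gt0 ?exprn_gt0// invrK invfM.
  by rewrite ltr_pdivrMl.
move=> h1 h2; exists (p%:R / b%:R ^+ j + m%:R - q, p%:R / b%:R ^+ j).
  apply/allpairsP; exists ((p, m), q); split=> //.
  by apply/allpairsP; exists (p, m); split=> //; rewrite mem_iota add0n.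
rewrite natrX in h1 h2; split=> //=; rewrite /ball/=.
by apply: lt_le_trans h1 _; lra.
Qed.

Lemma exists_rat_between (R : realType) (x : R) (y : \bar R) : (x%:E < y)%E ->
  exists2 q : rat, x < ratr q & ((ratr q)%:E < y)%E.
Proof.
case: y => [y| |//]; first rewrite lte_fin => /rat_in_itvoo[q].
  by rewrite in_itv/= => /andP[? ?]; exists q; rewrite ?lte_fin.
have /rat_in_itvoo[q] : x < x + 1 by rewrite ltrDl.
by rewrite in_itv/= => /andP[? _] _; exists q; rewrite ?ltry.
Qed.

Theorem theorem2p3 (R : realType) (b : nat) (hb : (2 <= b)%N) :
  {ae (@lebesgue_measure R), forall alpha : R, torus_pt alpha ->
     (forall xi, cantor_rot alpha xi ->
        (0 <= vb b xi)%E /\ (vb b xi <= (kappa_cantor R / (1 - kappa_cantor R))%:E)%E) /\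
     (forall v : R, 0 <= v <= kappa_cantor R / (1 - kappa_cantor R) ->
        (dimH (Vb b v `&` cantor_rot alpha) <= ((v + 1)^-1 + kappa_cantor R - 1)%:E)%E)}.
Proof.
have /andP[k0 k1] := kappa_cantor_gt0_lt1 R.
have k10 : 0 < 1 - kappa_cantor R by lra.
(* Rational pairs [(v, s)] are enumerated through [unpickle], so that one null set of angles serves
   for all of them. *)
have : {ae (@lebesgue_measure R), forall alpha : R, forall i : nat,
    forall v s : rat, unpickle i = Some (v, s) ->
    0 <= ratr s :> R -> 1 < (ratr v + 1) * (ratr s + 1 - kappa_cantor R) ->
    torus_pt alpha -> hausdorff_measure (ratr s)
      [set xi | cantor_rot alpha xi /\ ((ratr v)%:E < vb b xi)%E] = 0%E}.
  apply: ae_foralln => i; case: (unpickle i) => [[v s]|]; last first.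
    exact: aeW.
  have [s0|s0] := boolP (0 <= ratr s :> R); last first.
    by apply: aeW => alpha v' s' [_ <-] s0'; rewrite s0' in s0.
  have [vs|vs] := boolP (1 < (ratr v + 1) * (ratr s + 1 - kappa_cantor R)); last first.
    by apply: aeW => alpha v' s' [<- <-] _ vs'; rewrite vs' in vs.
  apply: ae_lebesgueS (ae_cantor_rot_hausdorff0 _ _ _ _ hb s0 vs).
  by move=> alpha H v' s' [<- <-] _ _.
apply: ae_lebesgueS => alpha H ta.
have {}H (v s : rat) : 0 <= ratr s :> R ->
    1 < (ratr v + 1) * (ratr s + 1 - kappa_cantor R) ->
    hausdorff_measure (ratr s)
      [set xi | cantor_rot alpha xi /\ ((ratr v)%:E < vb b xi)%E] = 0%E.
  by move=> s0 vs; exact: (H (pickle (v, s)) v s (pickleK _)).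
split=> [xi Kxi|v /andP[v0 vk]].
  split.
    rewrite /vb; case: ifPn => // _; apply: ereal_sup_ubound; exists 0 => // N.
    exists N; split=> //; by rewrite mul0r oppr0 powRr0 dnint_lt1.
  (* A rational [q] below the exponent with [q (1 - kappa) > kappa] satisfies
     [(q + 1) (1 - kappa) > 1], so [s = 0] is allowed and the resulting null set is empty, although
     it contains [xi]. *)
  rewrite leNgt; apply/negP => /exists_rat_between[q]; rewrite ltr_pdivrMr// => kq qv.
  have := H q 0; rewrite rmorph0 => /(_ (lexx _)) H0.
  have q1 : 1 < (ratr q + 1) * (0 + 1 - kappa_cantor R) by lra.
  have /hausdorff_measure0_set0 E0 := H0 q1.
  by have : set0 xi by rewrite -E0.
rewrite /dimH; case: ifPn => [_|_]; first exact: leNye.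
rewrite leNgt; apply/negP => /exists_rat_between[s s0].
apply/negP; rewrite -leNgt; apply: ereal_inf_lbound; exists (ratr s) => //.
have v1 : 0 < v + 1 by lra.
(* The upper limit on [v] makes the claimed bound nonnegative, hence also [ratr s] above it. *)
have s1 : 1 - kappa_cantor R <= (v + 1)^-1.
  by rewrite -[leRHS]mul1r ler_pdivlMr//; move: vk; rewrite ler_pdivlMr//; lra.
have sv : (v + 1)^-1 < ratr s + 1 - kappa_cantor R by lra.
have sp : 0 < ratr s + 1 - kappa_cantor R by rewrite (lt_trans _ sv)// invr_gt0.
split; first by lra.
(* A rational [q] slightly below [v] turns [v <= vb b xi] into the strict inequality of [H]; by [sv]
   there is room to keep [(q + 1) (s + 1 - kappa) > 1]. *)
have [q] : exists q : rat, ratr q \in `](ratr s + 1 - kappa_cantor R)^-1 - 1, v[.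
  by apply: rat_in_itvoo; rewrite ltrBlDr -[ltRHS]invrK ltf_pV2 ?posrE ?invr_gt0.
rewrite in_itv/= => /andP[q1 qv].
have qs : 1 < (ratr q + 1) * (ratr s + 1 - kappa_cantor R).
  by rewrite -ltr_pdivrMr// mul1r -ltrBlDr.
apply: hausdorff_measure0_subset (H q s _ qs); last by lra.
by move=> xi [[_ vxi] Kxi]; split=> //; apply: lt_le_trans vxi; rewrite lte_fin.
Qed.
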